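(* Let $G$ be a Hausdorff topological group, let $M\subseteq\omega$ be infinite, let $p$ be a free ultrafilter on $\omega$ with $M\in p$, and let $1\le k<\omega$. Let $f=(f_1,\ldots,f_k):M\to G^k$. Define $h:[M]^k\to G$ by $h(\{n_1,\ldots,n_k\})=f_1(n_1)\cdot\ldots\cdot f_k(n_k)$ whenever $n_1<\cdots<n_k$ are in $M$. If $y\in G$ is an $[M]^k$-cascade $p$-limit point of $h$, then $y=w_1\cdot\ldots\cdot w_k$, where, for each $i=1,\ldots,k$, $w_i\in G$ is a $p$-limit of $f_i$. Consequently, if $G$ is $k$-cascade countably compact, then $G^k$ is countably compact.
   Context: For infinite $M\subseteq\omega$ and $n\in\omega$, $[M]^n$ is the set of $n$-element subsets of $M$ (so $[M]^0=\{\emptyset\}$). If $p$ is a free ultrafilter on $\omega$, $A\in p$ and $(x_m:m\in A)$ is a family in a topological space $X$, then $x\in X$ is a $p$-limit of it if $\{m\in A:x_m\in U\}\in p$ for every neighborhood $U$ of $x$. Cascade limits: let $X$ be a topological space, $p$ a free ultrafilter on $\omega$ with $M\in p$, and $f$ a function into $X$ whose domain contains $[M]^n$. Recursively on $n$, $x\in X$ is an $[M]^n$-cascade $p$-limit point of $f$ if: for $n=0$, $f(\emptyset)=x$; for $n>0$, there exist $A\in p$ with $A\subseteq M$ and a family $(x_m:m\in A)$ in $X$ such that for every $m\in A$, $x_m$ is an $[M\setminus(m+1)]^{n-1}$-cascade $p$-limit point of the function $f_m:[M\setminus(m+1)]^{n-1}\to X$, $f_m(s)=f(\{m\}\cup s)$,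 and $x$ is a $p$-limit of $(x_m:m\in A)$. (Here $m+1=\{0,\dots,m\}$.) $X$ is $n$-cascade countably compact if for every $f:[\omega]^n\to X$ there is a free ultrafilter $p$ on $\omega$ such that $f$ has an $[\omega]^n$-cascade $p$-limit point in $X$. A space is countably compact if every sequence $(x_n:n\in\omega)$ in it has an accumulation point, i.e. a point each of whose neighborhoods contains $x_n$ for infinitely many $n$. *)

(* Defs.v *)
From HB Require Import structures.
From mathcomp Require Import all_boot all_order all_algebra finmap.
From mathcomp Require Import all_classical topology.

Set Implicit Arguments.
Unset Strict Implicit.
Unset Printing Implicit Defensive.

Local Open Scope classical_set_scope.

HB.mixin Record isTopologicalGroup G & Topological G & Group G := {
  mulg_continuous : continuous (fun x : G * G => (x.1 * x.2)%g) ;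
  invg_continuous : continuous (fun x : G => (x^-1)%g)
}.

#[short(type="topologicalGroupType")]
HB.structure Definition TopologicalGroup :=
  {G of Topological G & Group G & isTopologicalGroup G}.

Definition free_ultrafilter (p : set_system nat) : Prop :=
  UltraFilter p /\ \bigcap_(A in p) A = set0.

(* [M]^n *)
Definition nsubsets (M : set nat) (n : nat) : set {fset nat} :=
  [set s | [set` s] `<=` M /\ #|` s|%fset = n].

(* The family (x_m : m in A) is given by a total function whose values outside
   A are ignored. *)
Definition p_limit (X : topologicalType) (p : set_system nat) (A : set nat)
    (x : nat -> X) (l : X) : Prop :=
  forall U, nbhs l U -> p [set m | A m /\ U (x m)].

(* [cascade_limit p n M f x]: x is an [M]^n-cascade p-limit point of f. Only
   the values of f on [M]^n matter, see [eq_cascade_limit] below, so f is taken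
   total; `I_m.+1 is the set {0, ..., m}. *)
Fixpoint cascade_limit (X : topologicalType) (p : set_system nat) (n : nat)
    (M : set nat) (f : {fset nat} -> X) (x : X) : Prop :=
  if n is n'.+1 then
    exists (A : set nat) (y : nat -> X),
      [/\ p A, A `<=` M,
          forall m, A m ->
            cascade_limit p n' (M `\` `I_m.+1) (fun s => f (m |` s)%fset) (y m)
        & p_limit p A y x]
  else f fset0 = x.

Lemma eq_cascade_limit (X : topologicalType) (p : set_system nat) (n : nat)
    (M : set nat) (f g : {fset nat} -> X) (x : X) :
  (forall s, nsubsets M n s -> f s = g s) ->
  cascade_limit p n M f x -> cascade_limit p n M g x.
Proof.
elim: n M f g x => [|n IHn] M f g x fg /=.
  by rewrite fg //; split=> //; rewrite cardfs0.
move=> [A [y [pA AM yP yx]]]; exists A, y; split=> // m Am.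
apply: IHn (yP m Am) => s [sM ns]; apply: fg; split=> [i /=|].
  by rewrite in_fset1U => /orP[/eqP ->|/sM []//]; exact: AM.
rewrite cardfsU1 ns; case: (boolP (m \in s)) => [/sM [_ /=]|_ //].
by rewrite ltnSn.
Qed.

Definition cascade_countably_compact (n : nat) (X : topologicalType) : Prop :=
  forall f : {fset nat} -> X, exists p : set_system nat,
    free_ultrafilter p /\ exists x : X, cascade_limit p n [set: nat] f x.

Definition countably_compact (X : topologicalType) : Prop :=
  forall x : nat -> X, exists a : X,
    forall U, nbhs a U -> infinite_set [set n | U (x n)].

(* Main.v *)
Require Import Defs.
From mathcomp Require Import all_boot all_order all_algebra finmap.
From mathcomp Require Import all_classical topology.

Local Open Scope classical_set_scope.

(** The first assertion goes by induction on [k], proved for functions of the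
    form [c * f_1(n_1) * ... * f_k(n_k)] with a constant left factor [c], so that
    fixing the smallest element [n_1 = m] gives a function of the same form with
    [k - 1] factors and constant [c * f_1(m)].  If [y] is the [p]-limit of
    cascade limits [x_m] of these functions, the induction hypothesis gives
    [x_m = c * f_1(m) * w_2 * ... * w_k], where [w_i] is a [p]-limit of [f_i].
    Limits in a Hausdorff space being unique, [W = w_2 * ... * w_k] is the same
    for all [m].  Hence [f_1(m) = c^-1 * x_m * W^-1], and continuity of the
    multiplication shows that [f_1] has the [p]-limit [w_1 = c^-1 * y * W^-1];
    this is [cascade_limit_prod].

    For the second assertion, a sequence [x] in [G^k] is turned into the function
    that sends [{n_1 < ... < n_k}] to the product of the [i]-th coordinates of
    the [x(n_i)].  A cascade [p]-limit of it splits into coordinatewise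
    [p]-limits of [x], that is, into a [p]-limit in [G^k], which is an
    accumulation point since all members of a free ultrafilter are infinite. *)

(** Filter convergence does not mention the index set, so limits along
    different members of [p] become comparable. *)
Lemma p_limitP (X : topologicalType) (p : set_system nat) (A : set nat)
    (x : nat -> X) (l : X) :
  Filter p -> p A -> p_limit p A x l <-> (x m @[m --> p] --> l).
Proof.
move=> Fp pA; split=> [xl U /xl pU|xl U /xl pU].
  by apply: (@filterS _ p _ _ _ _ pU) => m [].
exact: filterI.
Qed.

Lemma cvg_mulg (G : topologicalGroupType) (T : Type) (F : set_system T)
    (f g : T -> G) (a b : G) :
  Filter F -> f x @[x --> F] --> a -> g x @[x --> F] --> b ->
  (f x * g x)%g @[x --> F] --> (a * b)%g.
Proof.
by move=> FF fa gb; apply: continuous2_cvg fa gb; exact: (mulg_continuous (a, b)).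
Qed.

Lemma cvg_ptws (I T : Type) (X : topologicalType) (F : set_system T)
    (x : T -> {ptws I -> X}) (l : {ptws I -> X}) :
  Filter F -> (forall i, x m i @[m --> F] --> l i) -> x m @[m --> F] --> l.
Proof.
move=> FF xl; apply/cvg_sup => i U.
have /= -> := @nbhsE (initial_topology (fun f : I -> X => f i)) l.
case=> B [[C oC <-] Cl] BU.
have FC : F [set m | C (x m i)] by apply: xl; exact: open_nbhs_nbhs.
by apply: (@filterS _ F _ _ _ _ FC) => m Cm; exact: BU.
Qed.

(** Freeness puts the complement of each point in [p], hence the complement of
    each finite set. *)
Lemma free_ultrafilter_infinite (p : set_system nat) (A : set nat) :
  free_ultrafilter p -> p A -> infinite_set A.
Proof.
move=> [Up p0] pA /finite_fsetP[S AS].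
have pC : p (\bigcap_(n in [set` S]) ~` [set n]).
  apply: filter_bigI => n _.
  have : ~ (\bigcap_(B in p) B) n by rewrite p0.
  move=> /existsNP[B /not_implyP[pB Bn]].
  by apply: filterS pB => m Bm mn; apply: Bn; rewrite -mn.
apply: (@filter_not_empty _ p); apply: filterS (filterI pA pC) => n [An].
by move=> /(_ n); apply=> //; rewrite -AS.
Qed.

(** The family [m, n_0, ..., n_(k-1)]: the cascade recursion removes the least
    element of a [k.+1]-element set, and this puts it back. *)
Definition ord_cons {k T} (m : T) (n : 'I_k -> T) (i : 'I_k.+1) : T :=
  if unlift ord0 i is Some j then n j else m.

Lemma ord_cons0 k T (m : T) (n : 'I_k -> T) : ord_cons m n ord0 = m.
Proof. by rewrite /ord_cons unlift_none. Qed.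

Lemma ord_consS k T (m : T) (n : 'I_k -> T) i :
  ord_cons m n (lift ord0 i) = n i.
Proof. by rewrite /ord_cons liftK. Qed.

Lemma imfset_ord_cons k (m : nat) (n : 'I_k -> nat) :
  [fset ord_cons m n i | i in 'I_k.+1]%fset = (m |` [fset n i | i in 'I_k])%fset.
Proof.
apply/fsetP => j; rewrite in_fset1U; apply/imfsetP/orP => /=.
  move=> [i _ ->]; case: (unliftP ord0 i) => [i' ->|->].
    by right; rewrite ord_consS; apply/imfsetP; exists i'.
  by left; rewrite ord_cons0.
move=> [/eqP ->|/imfsetP[/= i _ ->]].
  by exists ord0; rewrite ?ord_cons0.
by exists (lift ord0 i); rewrite ?ord_consS.
Qed.

(** The constant [c] makes the statement inductive: it absorbs the first factor
    [f m ord0] once the least element [m] is fixed.  The set [M] varies too, as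
    it shrinks to its part above [m]; so the limits are taken along [p] itself,
    to be comparable for different [m]. *)
Lemma cascade_limit_prod (G : topologicalGroupType) (p : set_system nat) (k : nat)
    (M : set nat) (f : nat -> 'I_k -> G) (c : G) (h : {fset nat} -> G) (y : G) :
  hausdorff_space G -> ProperFilter p ->
  (forall n : 'I_k -> nat,
     (forall i, M (n i)) -> (forall i j : 'I_k, (i < j)%N -> (n i < n j)%N) ->
     h [fset n i | i in 'I_k]%fset = (c * \prod_(i < k) f (n i) i)%g) ->
  cascade_limit p k M h y ->
  exists w : 'I_k -> G,
    y = (c * \prod_(i < k) w i)%g /\ forall i, f m i @[m --> p] --> w i.
Proof.
move=> hG Fp; elim: k M f c h y => [|k IHk] M f c h y hE /=.
  move=> <-; exists (fun=> 1%g); split=> [|[]//].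
  have := hE (fun=> 0); rewrite !big_ord0 => <-; [|by case..].
  by congr h; apply/fsetP => j; rewrite in_fset0; apply/esym/imfsetP => -[[]].
move=> [A [x [pA AM xh xy]]].
have tail m : A m -> exists w : 'I_k -> G,
    x m = (c * f m ord0 * \prod_(i < k) w i)%g /\
    forall i, f l (lift ord0 i) @[l --> p] --> w i.
  move=> Am; apply: IHk (xh m Am) => n nM n_incr.
  rewrite -imfset_ord_cons hE.
  - rewrite big_ord_recl ord_cons0 mulgA.
    by under eq_bigr do rewrite ord_consS.
  - move=> i; case: (unliftP ord0 i) => [i' ->|->].
      by rewrite ord_consS; case: (nM i').
    by rewrite ord_cons0; exact: AM.
  - move=> i j; case: (unliftP ord0 j) => [j' ->|->//].
    rewrite ord_consS; case: (unliftP ord0 i) => [i' ->|-> _].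
      by rewrite ord_consS /= /bump !leq0n !add1n ltnS; exact: n_incr.
    by rewrite ord_cons0; case: (nM j') => _ /negP; rewrite -leqNgt.
(* The limits w found for one index m0 serve for all m: they are limits of
   sequences that do not depend on m, hence unique. *)
have [m0 Am0] := filter_ex pA.
have [w [_ fw]] := tail m0 Am0.
set W := (\prod_(i < k) w i)%g.
have xE m : A m -> x m = (c * f m ord0 * W)%g.
  move=> Am; have [w' [-> fw']] := tail m Am; congr (_ * _)%g.
  by apply: eq_bigr => i _; exact: cvg_unique (fw' i) (fw i).
pose w0 := (c^-1 * (y * W^-1))%g.
have fw0 : f m ord0 @[m --> p] --> w0.
  have : (c^-1 * (x m * W^-1))%g @[m --> p] --> w0.
    by apply: cvg_mulg; [exact: cvg_cst|apply: cvg_mulg;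
      [apply/(p_limitP _ _ A)|exact: cvg_cst]].
  apply: cvg_trans; apply: near_eq_cvg.
  by apply: filterS pA => m /xE ->; rewrite mulgK mulKg.
exists (ord_cons w0 w); split.
  rewrite big_ord_recl ord_cons0.
  under eq_bigr do rewrite ord_consS.
  by rewrite -/W /w0 !mulgA mulgV mul1g mulgVK.
by move=> i; case: (unliftP ord0 i) => [i' ->|->]; rewrite ?ord_consS ?ord_cons0.
Qed.

(** Recovers an increasing enumeration from the set of its values, so that a
    function on [k]-element sets can use the [i]-th smallest element. *)
Lemma sort_imfset_increasing k (n : 'I_k -> nat) :
  (forall i j : 'I_k, (i < j)%N -> (n i < n j)%N) ->
  sort leq [fset n i | i in 'I_k]%fset = [seq n i | i <- enum 'I_k].
Proof.
move=> n_incr.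
have sorted_n : sorted ltn [seq n i | i <- enum 'I_k].
  rewrite sorted_map; apply: (@sub_sorted _ (relpre val ltn)) => [i j|].
    exact: n_incr.
  by rewrite -(sorted_map (f := val)) val_enum_ord iota_ltn_sorted.
apply: (sorted_eq leq_trans anti_leq).
- exact/sort_sorted/leq_total.
- by apply: sub_sorted sorted_n => i j /ltnW.
rewrite perm_sort; apply: uniq_perm; first exact: fset_uniq.
  by move: sorted_n; rewrite ltn_sorted_uniq_leq => /andP[].
move=> j; apply/imfsetP/mapP => /= -[i _ ->]; exists i => //.
by rewrite mem_enum.
Qed.

Theorem theorem5p1 (G : topologicalGroupType) (hG : hausdorff_space G)
    (k : nat) (hk : (1 <= k)%N) :
  (forall (M : set nat) (p : set_system nat) (f : nat -> {ptws 'I_k -> G})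
      (h : {fset nat} -> G) (y : G),
    infinite_set M -> free_ultrafilter p -> p M ->
    (forall n : 'I_k -> nat,
       (forall i, M (n i)) -> (forall i j : 'I_k, (i < j)%N -> (n i < n j)%N) ->
       h [fset n i | i in 'I_k]%fset = (\prod_(i < k) f (n i) i)%g) ->
    cascade_limit p k M h y ->
    exists w : 'I_k -> G,
      y = (\prod_(i < k) w i)%g /\
      forall i, p_limit p M (fun m => f m i) (w i))
  /\ (cascade_countably_compact k G -> countably_compact {ptws 'I_k -> G}).
Proof.
split=> [M p f h y _ [Up _] pM hE hy|ccG x].
  have [n nM n_incr|w [-> fw]] := cascade_limit_prod G p k M f 1%g h y hG _ _ hy.
    by rewrite mul1g hE.
  exists w; rewrite mul1g; split=> // i.
  by apply/p_limitP => //; exact: fw.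
pose h (s : {fset nat}) := (\prod_(i < k) x (nth 0 (sort leq s) i) i)%g.
have [p [pfree [y hy]]] := ccG h; have [Up _] := pfree.
have [n _ n_incr|w [_ xw]] := cascade_limit_prod G p k setT x 1%g h y hG _ _ hy.
  rewrite mul1g; apply: eq_bigr => i _; rewrite sort_imfset_increasing //.
  by rewrite (nth_map i) ?size_enum_ord // nth_ord_enum.
exists w => U wU; apply: (free_ultrafilter_infinite p _ pfree).
exact: (cvg_ptws _ _ _ _ _ _ _ xw).
Qed.
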